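(* For any given weights $w_i\ge 0$, $i=1,\ldots,p$, with $\sum_{i=1}^p w_i=1$, and any given $\lambda>0$: (a) the GOWA robust optimal value of $\mathcal{P}(\Omega)$ never exceeds the min-max robust optimal value of $\mathcal{P}(\Omega)$; (b) the GOWA robust optimal value of $\mathcal{P}(\Omega)$ is greater than or equal to the min-min robust optimal value of $\mathcal{P}(\Omega)$.
   Context: Setting: $\Omega=\{\zeta_1,\ldots,\zeta_p\}\subseteq\mathbb{R}^m$ is a finite (ordered) uncertainty set, $\mathcal{X}\subseteq\mathbb{R}^n$ is a compact feasible set independent of $\Omega$, and $f:\mathcal{X}\times\Omega\to\mathbb{R}$ satisfies $f(x,\zeta)\ge 0$ for all $x\in\mathcal{X}$, $\zeta\in\Omega$. The uncertain single objective optimization problem $\mathcal{P}(\Omega)$ is the family of problems $\min_{x\in\mathcal{X}} f(x,\zeta)$, $\zeta\in\Omega$. Auxiliary functions $s_1,\ldots,s_p:\mathcal{X}\to\mathbb{R}$: for each $x$, recursively for $i=1,\ldots,p$, let $j_i(x)$ be the smallest index among those $j\in\{1,\ldots,p\}\setminus\{j_1(x),\ldots,j_{i-1}(x)\}$ at which $f(x,\zeta_j)$ is maximal over that remaining index set, and put $s_i(x)=f(x,\zeta_{j_i(x)})$. Thus exactly one index is removed at each step, so $s_i(x)$ is the $i$-th largest of the values $f(x,\zeta_1),\ldots,f(x,\zeta_p)$ counted with multiplicity. The GOWA robust objective function is $\phi(x)=\left(\sum_{i=1}^{p}w_i(s_i(x))^{\lambda}\right)^{1/\lambda}$, $x\in\mathcal{X}$.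 The GOWA, min-max and min-min robust optimal values of $\mathcal{P}(\Omega)$ are the optimal values (infima over $\mathcal{X}$) of the problems of minimizing over $x\in\mathcal{X}$, respectively, $\phi(x)$, $\max_{\zeta\in\Omega}f(x,\zeta)$, and $\min_{\zeta\in\Omega}f(x,\zeta)$. *)

(* Defs.v *)
From HB Require Import structures.
From mathcomp Require Import all_boot all_order all_algebra.
From mathcomp Require Import all_classical all_reals all_analysis.

Set Implicit Arguments.
Unset Strict Implicit.
Unset Printing Implicit Defensive.

Import Order.TTheory GRing.Theory Num.Theory.
Import numFieldNormedType.Exports.

Local Open Scope classical_set_scope.
Local Open Scope ring_scope.

(* In the selection of s_1(x), ..., s_p(x), the family v stands for the values
   f(x, zeta_1), ..., f(x, zeta_p); indices are 0-based. *)
Definition argmax_set (R : realType) (p : nat) (v : 'I_p -> R)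
    (A : {set 'I_p}) : {set 'I_p} :=
  [set j in A | [forall k in A, v k <= v j]]%SET.

(* [None] only when A is empty. *)
Definition first_argmax (R : realType) (p : nat) (v : 'I_p -> R)
    (A : {set 'I_p}) : option 'I_p :=
  [pick j in argmax_set v A | [forall k in argmax_set v A, (j <= k)%N]].

Fixpoint removed (R : realType) (p : nat) (v : 'I_p -> R) (i : nat) :
    {set 'I_p} :=
  if i is i'.+1 then
    if first_argmax v (~: removed v i')%SET is Some j
    then (j |: removed v i')%SET else removed v i'
  else finset.set0.

(* For i : 'I_p only i < p indices have been removed, so the default value of
   [odflt] is never reached. *)
Definition selected (R : realType) (p : nat) (v : 'I_p -> R) (i : 'I_p) :
    'I_p :=
  odflt i (first_argmax v (~: removed v i)%SET).

Definition s_aux (R : realType) (m n p : nat) (zeta : 'I_p -> 'rV[R]_m)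
    (f : 'rV[R]_n -> 'rV[R]_m -> R) (i : 'I_p) (x : 'rV[R]_n) : R :=
  f x (zeta (selected (fun j => f x (zeta j)) i)).

Definition gowa_objective (R : realType) (m n p : nat)
    (zeta : 'I_p -> 'rV[R]_m) (f : 'rV[R]_n -> 'rV[R]_m -> R)
    (w : 'I_p -> R) (lambda : R) (x : 'rV[R]_n) : R :=
  (\sum_(i < p) w i * (s_aux zeta f i x) `^ lambda) `^ (lambda^-1).

(* The neutral elements -oo and +oo do not contribute as soon as 0 < p. *)
Definition minmax_objective (R : realType) (m n p : nat)
    (zeta : 'I_p -> 'rV[R]_m) (f : 'rV[R]_n -> 'rV[R]_m -> R)
    (x : 'rV[R]_n) : \bar R :=
  \big[maxe/-oo%E]_(i < p) (f x (zeta i))%:E.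

Definition minmin_objective (R : realType) (m n p : nat)
    (zeta : 'I_p -> 'rV[R]_m) (f : 'rV[R]_n -> 'rV[R]_m -> R)
    (x : 'rV[R]_n) : \bar R :=
  \big[mine/+oo%E]_(i < p) (f x (zeta i))%:E.

(* Infimum in the extended reals: it is +oo when X is empty. *)
Definition optimal_value (R : realType) (n : nat) (X : set 'rV[R]_n)
    (g : 'rV[R]_n -> \bar R) : \bar R :=
  ereal_inf [set g x | x in X].

Definition gowa_value (R : realType) (m n p : nat) (X : set 'rV[R]_n)
    (zeta : 'I_p -> 'rV[R]_m) (f : 'rV[R]_n -> 'rV[R]_m -> R)
    (w : 'I_p -> R) (lambda : R) : \bar R :=
  optimal_value X (fun x => (gowa_objective zeta f w lambda x)%:E).

Definition minmax_value (R : realType) (m n p : nat) (X : set 'rV[R]_n)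
    (zeta : 'I_p -> 'rV[R]_m) (f : 'rV[R]_n -> 'rV[R]_m -> R) : \bar R :=
  optimal_value X (minmax_objective zeta f).

Definition minmin_value (R : realType) (m n p : nat) (X : set 'rV[R]_n)
    (zeta : 'I_p -> 'rV[R]_m) (f : 'rV[R]_n -> 'rV[R]_m -> R) : \bar R :=
  optimal_value X (minmin_objective zeta f).

(* Main.v *)
Require Import Defs.
From HB Require Import structures.
From mathcomp Require Import all_boot all_order all_algebra.
From mathcomp Require Import all_classical all_reals all_analysis.

(** For each feasible [x], the GOWA objective is a weighted power mean, of
    exponent [lambda], of values that [f x] takes on the uncertainty set.  A
    power mean of nonnegative values lies between any nonnegative lower bound
    and any upper bound of these values:
    [t |-> t `^ lambda] is nondecreasing on the nonnegative reals, an average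
    with weights of sum 1 stays between the bounds of its terms, and
    [t |-> t `^ lambda^-1] undoes the power.  Taking the largest and the
    smallest of the [f x (zeta i)] as bounds gives the pointwise inequalities
    between the objectives ([gowa_le_minmax], [minmin_le_gowa]), and
    inequalities between objectives pass to their infima
    ([le_optimal_value]).  The bounds apply to every
    [s_aux zeta f i x] because each is one of the [f x (zeta j)]. *)

Set Implicit Arguments.
Unset Strict Implicit.
Unset Printing Implicit Defensive.

Import Order.TTheory GRing.Theory Num.Theory.
Import numFieldNormedType.Exports.

Local Open Scope classical_set_scope.
Local Open Scope ring_scope.

Definition power_mean (R : realType) (p : nat) (w s : 'I_p -> R) (lambda : R) :=
  (\sum_(i < p) w i * s i `^ lambda) `^ lambda^-1.

Lemma powRK_inv (R : realType) (lambda a : R) :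
  0 < lambda -> 0 <= a -> (a `^ lambda) `^ lambda^-1 = a.
Proof.
by move=> l_gt0 a_ge0; rewrite -powRrM mulfV ?gt_eqF// powRr1.
Qed.

Section PowerMeanBounds.
Variables (R : realType) (p : nat) (w s : 'I_p -> R) (lambda a : R).
Hypotheses (w_ge0 : forall i, 0 <= w i) (w_sum1 : \sum_(i < p) w i = 1).
Hypothesis lambda_gt0 : 0 < lambda.

(** Writing [a] as [(a `^ lambda) `^ lambda^-1], the power mean of the constant
    family [a], reduces this bound, and the next one, to comparing the weighted
    averages inside the outer power. *)
Lemma power_mean_le :
  0 <= a -> (forall i, 0 <= s i <= a) -> power_mean w s lambda <= a.
Proof.
move=> a_ge0 s_bd; rewrite -[leRHS](powRK_inv lambda_gt0)//.
apply: ge0_ler_powR; rewrite ?invr_ge0 ?(ltW lambda_gt0)// ?nnegrE ?powR_ge0//.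
  by apply: sumr_ge0 => i _; rewrite mulr_ge0// powR_ge0.
rewrite -[leRHS]mul1r -w_sum1 mulr_suml; apply: ler_sum => i _.
have /andP[s_ge0 s_le] := s_bd i.
by apply: ler_wpM2l => //; apply: ge0_ler_powR; rewrite ?nnegrE ?(ltW lambda_gt0).
Qed.

Lemma power_mean_ge :
  0 <= a -> (forall i, a <= s i) -> a <= power_mean w s lambda.
Proof.
move=> a_ge0 s_ge; rewrite -[leLHS](powRK_inv lambda_gt0)//.
apply: ge0_ler_powR; rewrite ?invr_ge0 ?(ltW lambda_gt0)// ?nnegrE ?powR_ge0//.
  by apply: sumr_ge0 => i _; rewrite mulr_ge0// powR_ge0.
rewrite -[leLHS]mul1r -w_sum1 mulr_suml; apply: ler_sum => i _.
apply: ler_wpM2l => //; apply: ge0_ler_powR; rewrite ?nnegrE ?(ltW lambda_gt0)//.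
exact: le_trans (s_ge i).
Qed.

End PowerMeanBounds.

Lemma le_optimal_value (R : realType) (n : nat) (X : set 'rV[R]_n)
    (g h : 'rV[R]_n -> \bar R) :
  (forall x, X x -> (g x <= h x)%E) -> (optimal_value X g <= optimal_value X h)%E.
Proof.
move=> gh; apply: le_ereal_inf_tmp => _ [x Xx <-].
by apply: le_trans (gh x Xx); apply: ereal_inf_lbound; exists x.
Qed.

Section Pointwise.
Variables (R : realType) (m n p : nat) (zeta : 'I_p -> 'rV[R]_m).
Variables (f : 'rV[R]_n -> 'rV[R]_m -> R) (x : 'rV[R]_n).
Hypothesis f_ge0 : forall i, 0 <= f x (zeta i).
Variables (w : 'I_p -> R) (lambda : R).
Hypotheses (w_ge0 : forall i, 0 <= w i) (w_sum1 : \sum_(i < p) w i = 1).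
Hypothesis lambda_gt0 : 0 < lambda.

(** Without a scenario the empty sum of weights would be 0. *)
Lemma scenario_exists : exists i : 'I_p, true.
Proof.
apply: contrapT => no_i; have /eqP := w_sum1.
rewrite big1 ?(eq_sym 0) ?oner_eq0// => i _.
by case: no_i; exists i.
Qed.

Lemma gowa_le_minmax :
  ((gowa_objective zeta f w lambda x)%:E <= minmax_objective zeta f x)%E.
Proof.
have [i0 _] := scenario_exists.
(* A real bound is needed for the power mean, so the extended-real maximum is
   replaced by a value that attains it. *)
case: (@arg_maxP _ _ _ i0 xpredT (fun i => f x (zeta i)) isT) => i _ max_i.
have le_i : ((f x (zeta i))%:E <= minmax_objective zeta f x)%E by exact: le_bigmax.
apply: le_trans le_i; rewrite lee_fin.
by apply: power_mean_le => // j; rewrite f_ge0; exact: max_i.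
Qed.

Lemma minmin_le_gowa :
  (minmin_objective zeta f x <= (gowa_objective zeta f w lambda x)%:E)%E.
Proof.
have [i0 _] := scenario_exists.
case: (@arg_minP _ _ _ i0 xpredT (fun i => f x (zeta i)) isT) => i _ min_i.
have ge_i : (minmin_objective zeta f x <= (f x (zeta i))%:E)%E by exact: bigmin_le.
apply: (le_trans ge_i); rewrite lee_fin.
by apply: power_mean_ge => // j; exact: min_i.
Qed.

End Pointwise.

Theorem theorem4p7 (R : realType) (m n p : nat)
    (zeta : 'I_p -> 'rV[R]_m) (X : set 'rV[R]_n)
    (f : 'rV[R]_n -> 'rV[R]_m -> R)
    (X_compact : compact X)
    (f_ge0 : forall (x : 'rV[R]_n) (i : 'I_p), X x -> 0 <= f x (zeta i))
    (w : 'I_p -> R) (w_ge0 : forall i : 'I_p, 0 <= w i)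
    (w_sum1 : \sum_(i < p) w i = 1)
    (lambda : R) (lambda_gt0 : 0 < lambda) :
  (gowa_value X zeta f w lambda <= minmax_value X zeta f)%E /\
  (minmin_value X zeta f <= gowa_value X zeta f w lambda)%E.
Proof.
split; apply: le_optimal_value => x Xx.
  by apply: gowa_le_minmax => // i; exact: f_ge0.
by apply: minmin_le_gowa => // i; exact: f_ge0.
Qed.
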